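(* Let $p,q,r\in(0,1/36)$, $h=8/15$, $a=3/15$, and let $K_{pqr}$ be the attractor of $\mathcal S_{pqr}=\{S_1,\dots,S_6\}$ with $S_1(x)=px$, $S_2(x)=a+rx$, $S_3(x)=h-qx$, $S_4(x)=h-r+rx$, $S_5(x)=1-a-rx$, $S_6(x)=1-r+rx$. If $S_3(K_{pqr})\cap S_4(K_{pqr})=\{h\}$, then $d=\dim_H K_{pqr}$ satisfies $p^d+q^d+4r^d=1$.
   Context: $\dim_H$ denotes Hausdorff dimension. *)

(* Defs.v *)
From HB Require Import structures.
From mathcomp Require Import all_boot all_order all_algebra.
From mathcomp Require Import all_classical all_reals all_analysis.
Set Implicit Arguments. Unset Strict Implicit. Unset Printing Implicit Defensive.
Import Order.TTheory GRing.Theory Num.Theory.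
Import numFieldNormedType.Exports.
Local Open Scope classical_set_scope.
Local Open Scope ring_scope.

Section Hausdorff.
Variable R : realType.

(* diameter of a subset of R (in the extended reals; -oo for the empty set) *)
Definition diamE (U : set R) : \bar R :=
  ereal_sup [set (`|x.1 - x.2|)%:E | x in U `*` U].

(* |U|^s, with the usual convention |emptyset|^s = 0 *)
Definition dpow (s : R) (U : set R) : \bar R :=
  if pselect (U = set0) then 0%E else
  match diamE U with
  | r%:E => (r `^ s)%:E
  | +oo%E => +oo%E
  | -oo%E => 0%E
  end.

Definition hausdorff_delta (s d : R) (A : set R) : \bar R :=
  ereal_inf [set (\sum_(0 <= i <oo) dpow s (U i))%E |
     U in [set U : nat -> set R |
        A `<=` \bigcup_i U i /\ forall i, (diamE (U i) <= d%:E)%E]].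

Definition hausdorff_measure (s : R) (A : set R) : \bar R :=
  ereal_sup [set hausdorff_delta s d A | d in [set d : R | 0 < d]].

Definition hausdorff_dim (A : set R) : \bar R :=
  ereal_inf [set s%:E | s in [set s : R | 0 <= s /\ hausdorff_measure s A = 0%E]].

Definition is_attractor (S : seq (R -> R)) (K : set R) : Prop :=
  [/\ compact K, K !=set0 & K = \big[setU/set0]_(f <- S) (f @` K)].

End Hausdorff.

(* Main.v *)
(* Put phi(s) = p^s + q^s + 4 r^s, and let d be the solution of phi(d) = 1.

   Upper bound: for s > d the level-n pieces S_w(K) cover K, have diameter at
   most 36^-n, and their s-th powers sum to at most phi(s)^n, which tends to 0.

   Lower bound: only S_3(K) and S_4(K) meet, in the single point h = S_3(0).
   Restrict to the words u2 with |u| = n. The pieces S_(u2)(K) are pairwise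
   disjoint: two of them can only meet through the letters 3 and 4, at h, which
   forces 0 into an image of S_2(K), and that is impossible. For s < d the
   ratios of these words satisfy sum rho^s = phi(s)^n r^s >= 1 for n large. A
   finite cover of K whose members are all smaller than the least gap between
   the pieces splits into covers of the individual pieces; rescaling these and
   inducting on the number of members bounds the s-sum of every finite cover
   from below, and compactness passes to countable covers. *)

Require Import Defs.
From HB Require Import structures.
From mathcomp Require Import all_boot all_order all_algebra.
From mathcomp Require Import all_classical all_reals all_analysis.
From mathcomp Require Import finmap ring lra.
Import Order.TTheory GRing.Theory Num.Theory.
Import numFieldNormedType.Exports.
Local Open Scope classical_set_scope.
Local Open Scope ring_scope.

(** * Vanishing and non-vanishing of Hausdorff measure for sets with similar pieces *)

Section Hausdorff_bounds.
Context {R : realType}.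
Implicit Types (K : set R) (s : R).

(** The set of differences is compact, hence closed, and misses 0. The [near] form lets one gap
    serve finitely many pairs. *)
Lemma disjoint_compact_dist (A B : set R) :
  compact A -> compact B -> A `&` B = set0 ->
  \forall e \near 0^'+, forall x y, A x -> B y -> e <= `|x - y|.
Proof.
move=> cA cB AB0.
have cAB : compact [set z.1 - z.2 | z in A `*` B].
  apply: continuous_compact; last exact: compact_setX.
  apply: continuous_subspaceT => z.
  by apply: cvgB; [exact: cvg_fst | exact: cvg_snd].
have oC : open (~` [set z.1 - z.2 | z in A `*` B]).
  by apply: closed_openC; apply: compact_closed => //; exact: norm_hausdorff.
have nC0 : ~ [set z.1 - z.2 | z in A `*` B] 0.
  move=> [[x y] /= [Ax By] /eqP]; rewrite subr_eq0 => /eqP xy.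
  by have : (A `&` B) x; [split=> //; rewrite xy | rewrite AB0].
have [e /= e0 he] := open_nbhs_nbhs (conj oC nC0).
near=> d => x y Ax By; rewrite leNgt; apply/negP => xyd.
have xye : ball 0 e (x - y).
  rewrite -ball_normE/= sub0r normrN (lt_le_trans xyd)//.
  by near: d; exact: nbhs_right_le.
by apply: (he _ xye); exists (x, y).
Unshelve. all: by end_near. Qed.

Lemma covering_sum_ge (T : finType) (f : T -> R -> R) (rho : T -> R) K s del :
  (1 < #|T|)%N -> 0 <= s -> 0 < del -> K !=set0 ->
  (forall t, 0 < rho t) ->
  (forall t x y, `|f t x - f t y| = rho t * `|x - y|) ->
  (forall t x, K x -> K (f t x)) ->
  (forall t t' x y, t != t' -> K x -> K y -> del <= `|f t x - f t' y|) ->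
  1 <= \sum_t rho t `^ s ->
  forall (J : seq nat) (U : nat -> set R) (d : nat -> R),
    (forall i x y, i \in J -> U i x -> U i y -> `|x - y| <= d i) ->
    (forall i, i \in J -> 0 <= d i) ->
    (forall x, K x -> exists2 i, i \in J & U i x) ->
  del `^ s <= \sum_(i <- J) d i `^ s.
Proof.
move=> T1 s0 del0 [x0 Kx0] rho0 fsim fK sep sum1 J.
have [n] := ubnP (size J); elim: n J => // n IH J szJ U d Ud d0 KU.
have [/hasP[i iJ deli]|/hasPn small] := boolP (has (fun i => del <= d i) J).
  rewrite (big_rem i)//= -[X in X <= _]addr0 lerD//.
    by rewrite ge0_ler_powR ?nnegrE ?d0// ltW.
  by rewrite sumr_ge0// => *; exact: powR_ge0.
pose meets t i := `[< exists2 x, K x & U i (f t x) >].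
have meets_uniq i t t' : i \in J -> meets t i -> meets t' i -> t = t'.
  move=> iJ /asboolP[x Kx Ux] /asboolP[y Ky Uy]; apply/eqP/negPn/negP => tt'.
  have := le_trans (sep _ _ _ _ tt' Kx Ky) (Ud _ _ _ iJ Ux Uy).
  by apply/negP/small.
have piece t : del `^ s * rho t `^ s <= \sum_(i <- J | meets t i) d i `^ s.
  have [t' tt'] : exists t', t' != t.
    move: T1; rewrite (cardD1 t) inE add1n ltnS => /card_gt0P[t' /[!inE]].
    by move=> /andP[? _]; exists t'.
  have [i iJ Ui] := KU _ (fK t' _ Kx0).
  have mt'i : meets t' i by apply/asboolP; exists x0.
  have : del `^ s <= \sum_(i <- [seq i <- J | meets t i]) (d i / rho t) `^ s.
    apply: (IH _ _ (fun i => f t @^-1` U i)).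
    (* The member [i] meets the piece [t'], hence not [t], so the subfamily for [t] is strictly
       smaller. *)
    - rewrite size_filter -ltnS (leq_trans _ szJ)// ltnS ltn_neqAle count_size andbT.
      rewrite -all_count; apply/negP => /allP/(_ _ iJ) mti.
      by move: tt'; rewrite (meets_uniq _ _ _ iJ mti mt'i) eqxx.
    - move=> j x y; rewrite mem_filter => /andP[_ jJ] Ux Uy.
      by rewrite ler_pdivlMr// mulrC -fsim (Ud j).
    - by move=> j; rewrite mem_filter => /andP[_ jJ]; rewrite divr_ge0 ?d0 ?ltW.
    - move=> x Kx; have [j jJ Uj] := KU _ (fK t _ Kx).
      by exists j => //; rewrite mem_filter jJ andbT; apply/asboolP; exists x.
  rewrite big_filter -(ler_pM2r (powR_gt0 s (rho0 t))) => /le_trans; apply.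
  rewrite mulr_suml big_seq_cond [leRHS]big_seq_cond ler_sum// => j /andP[jJ _].
  have rt0 := rho0 t; rewrite -powRM ?divfK ?gt_eqF ?divr_ge0 ?d0//; exact: ltW.
apply: (@le_trans _ _ (\sum_t \sum_(i <- J | meets t i) d i `^ s)).
  apply: le_trans (ler_sum _ (fun t _ => piece t)).
  by rewrite -mulr_sumr ler_peMr// powR_ge0.
rewrite (exchange_big_dep predT)//= big_seq [leRHS]big_seq ler_sum// => i iJ.
have [t mt|none] := pickP (meets^~ i); last by rewrite big_pred0 ?powR_ge0.
rewrite (big_pred1 t)// => t'; rewrite /pred1/=; apply/idP/eqP => [mt'|->//].
exact: meets_uniq mt' mt.
Qed.

Lemma dpow_ge0 s (U : set R) : (0 <= dpow s U)%E.
Proof.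
rewrite /dpow; case: pselect => ? //=.
by case: (diamE U) => [x| |]//; rewrite lee_fin powR_ge0.
Qed.

(** The witness is the diameter, which is finite: nonemptiness rules out [-oo], and [c] rules out
    [+oo]. *)
Lemma dpow_bounded s (U : set R) (c : R) : U !=set0 -> (diamE U <= c%:E)%E ->
  exists r, [/\ 0 <= r <= c, forall x y, U x -> U y -> `|x - y| <= r
   & dpow s U = (r `^ s)%:E].
Proof.
move=> [x Ux] Uc; have Udist y z : U y -> U z -> (`|y - z|%:E <= diamE U)%E.
  by move=> Uy Uz; apply: ereal_sup_ubound; exists (y, z).
rewrite /dpow; case: pselect => [U0|?] /=; first by move: Ux; rewrite U0.
move: Uc Udist; case: (diamE U) => [r| |]// rc Udist; last first.
  by have := Udist _ _ Ux Ux.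
exists r; split => //.
by have := Udist _ _ Ux Ux; rewrite subrr normr0 !lee_fin => ->; rewrite -lee_fin.
Qed.

(** Used to enlarge a cover member of diameter [d] to an open ball of radius [t] at a controlled
    cost. The slack [e] pays for members of diameter 0, whose ball still needs a positive radius. *)
Lemma powR_double_radius s (d e : R) : 0 <= s -> 0 <= d -> 0 < e ->
  exists2 t, d < t & (2 * t) `^ s <= (4 * d) `^ s + e.
Proof.
move=> s0 d0 e0.
have [->|sn0] := eqVneq s 0.
  by exists (d + 1); rewrite ?ltrDl// !powRr0 lerDl ltW.
have [->|dn0] := eqVneq d 0.
  exists (e `^ s^-1 / 2); first by rewrite divr_gt0 ?powR_gt0.
  by rewrite mulr0 powR0// add0r mulrC divfK// -powRrM mulVf// powRr1// ltW.
have dgt0 : 0 < d by rewrite lt_neqAle eq_sym dn0.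
exists (2 * d); first lra.
by rewrite mulrA -natrM lerDl ltW.
Qed.

(** Measure zero would give a cheap countable cover; enlarged to open balls it has a finite
    subcover, still too cheap for [covering_sum_ge]. *)
Lemma hausdorff_measure_neq0 (T : finType) (f : T -> R -> R) (rho : T -> R) K s :
  (1 < #|T|)%N -> 0 <= s -> compact K -> K !=set0 ->
  (forall t, 0 < rho t) ->
  (forall t x y, `|f t x - f t y| = rho t * `|x - y|) ->
  (forall t x, K x -> K (f t x)) ->
  (forall t t', t != t' -> f t @` K `&` f t' @` K = set0) ->
  1 <= \sum_t rho t `^ s ->
  hausdorff_measure s K <> 0%E.
Proof.
move=> T1 s0 cK K0 rho0 fsim fK disj sum1 HK0.
have cf t : compact (f t @` K).
  apply: continuous_compact => //; apply: continuous_subspaceT => x.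
  apply/cvgrPdist_lt => e e0; near=> y; rewrite fsim mulrC -ltr_pdivlMr//.
  near: y; apply/nbhs_normP; exists (e / rho t) => //=.
  by rewrite divr_gt0.
have near_sep : \forall e \near (0 : R)^'+, forall tt : T * T, tt.1 != tt.2 ->
    forall x y, (f tt.1 @` K) x -> (f tt.2 @` K) y -> e <= `|x - y|.
  apply: filter_forall => -[t t']; have [->|tt'] := eqVneq t t'.
    by apply: nearW => e /= /eqP.
  by apply: filterS (disjoint_compact_dist _ _ (cf t) (cf t') (disj _ _ tt')) => e + _.
have [del [del0 sep]] := filter_ex (filterI (nbhs_right_gt 0) near_sep).
have cover_ge := @covering_sum_ge _ f rho K s del T1 s0 del0 K0 rho0 fsim fK _ sum1.
(* Chosen so that [4]^ s * eps + eps = del [^ s]: the first term pays for doubling the diameters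
   twice, the second for all the slacks [eps / 2 ^ i.+1]. *)
pose eps := del `^ s / (4 `^ s + 1).
have c0 : 0 < 4 `^ s + 1 :> R by rewrite ltr_wpDl ?powR_ge0.
have eps0 : 0 < eps by rewrite divr_gt0 ?powR_gt0.
have /ereal_inf_lt[_ [U [KU U1] <-] Ueps] : (hausdorff_delta s 1 K < eps%:E)%E.
  apply: (@le_lt_trans _ _ 0%E); last by rewrite lte_fin.
  rewrite -HK0; apply: ereal_sup_ubound; exists 1 => //=; exact: ltr01.
(* The triple holds a centre in [U i], the diameter of [U i] and the radius of a ball containing it;
   empty members get a dummy. *)
have /choice[g gP] i : exists xrt : R * R * R, U i !=set0 ->
    [/\ dpow s (U i) = (xrt.1.2 `^ s)%:E, 0 < xrt.2,
        U i `<=` ball xrt.1.1 xrt.2 &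
        (2 * xrt.2) `^ s <= 4 `^ s * xrt.1.2 `^ s + eps / (2 ^ i.+1)%:R].
  have [[x Ux]|nU] := pselect (U i !=set0); last by exists (0, 0, 0).
  have [|r [/andP[r0 r1] Ur Usr]] := dpow_bounded s _ 1 _ (U1 i); first by exists x.
  have [|t rt ts] := powR_double_radius _ _ (eps / (2 ^ i.+1)%:R) s0 r0.
    by rewrite divr_gt0// ltr0n expn_gt0.
  exists (x, r, t) => _; split => //=; first exact: le_lt_trans rt.
    move=> y Uy; rewrite -ball_normE/=; exact: le_lt_trans (Ur _ _ Ux Uy) rt.
  by rewrite -powRM.
have : cover_compact K by rewrite -compact_cover.
move=> /(_ nat [set i | U i !=set0] (fun i => ball (g i).1.1 (g i).2))[].
- by move=> i _; exact: ball_open.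
- move=> x /KU[i _ Ux]; have Ui0 : U i !=set0 by exists x.
  by exists i => //; have [_ _ + _] := gP i Ui0; exact.
move=> J JU KJ.
have {}gP i : i \in J -> [/\ dpow s (U i) = ((g i).1.2 `^ s)%:E, 0 < (g i).2 &
    (2 * (g i).2) `^ s <= 4 `^ s * (g i).1.2 `^ s + eps / (2 ^ i.+1)%:R].
  by move=> /JU /set_mem /gP[].
have sum_le (a : nat -> \bar R) : (forall i, (0 <= a i)%E) ->
    (\sum_(i <- J) a i <= \sum_(0 <= i <oo) a i)%E.
  move=> a0; rewrite nneseries_esumT//.
  apply: esum_ge; exists [set` J]; first by split.
  by rewrite fsbig_finite//= set_fsetK.
have: \sum_(i <- J) (2 * (g i).2) `^ s < del `^ s.
  apply: (@le_lt_trans _ _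
    (\sum_(i <- J) (4 `^ s * (g i).1.2 `^ s + eps / (2 ^ i.+1)%:R))).
    by rewrite big_seq [leRHS]big_seq ler_sum// => i /gP[].
  rewrite big_split/= -mulr_sumr.
  have -> : del `^ s = 4 `^ s * eps + eps.
    by rewrite -{2}[eps]mul1r -mulrDl mulrC divfK ?gt_eqF.
  apply: ltr_leD.
    rewrite ltr_pM2l ?powR_gt0// -lte_fin; apply: le_lt_trans Ueps.
    apply: le_trans (sum_le _ (fun i => dpow_ge0 s (U i))).
    by rewrite -sumEFin big_seq [leRHS]big_seq lee_sum// => i /gP[->].
  rewrite -lee_fin -sumEFin; apply: le_trans (epsilon_trick0 xpredT (ltW eps0)).
  by apply: sum_le => i; rewrite lee_fin divr_ge0// ltW.
apply/negP; rewrite -leNgt; apply: (cover_ge _ _ (fun i => ball (g i).1.1 (g i).2)).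
- move=> t t' x y tt' Kx Ky; apply: (sep (t, t')) => //=; [by exists x|by exists y].
- move=> i x y _; rewrite -ball_normE/= => xi yi.
  rewrite -(subrKA (g i).1.1) (le_trans (ler_normD _ _))// mulr2n mulrDl !mul1r.
  by rewrite lerD ?ltW// distrC.
- by move=> i /gP[_ gi _]; rewrite mulr_ge0// ltW.
- by move=> x /KJ[i iJ xi]; exists i.
Unshelve. all: by end_near. Qed.

Lemma diamE_le (U : set R) (c : R) :
  (forall x y, U x -> U y -> `|x - y| <= c) -> (diamE U <= c%:E)%E.
Proof.
by move=> Uc; apply: ge_ereal_sup => _ [[x y] [/= Ux Uy] <-]; rewrite lee_fin Uc.
Qed.

Lemma hausdorff_measure_ge0 s (A : set R) : (0 <= hausdorff_measure s A)%E.
Proof.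
apply: le_ereal_sup_tmp; exists (hausdorff_delta s 1 A).
  by exists 1 => //=; exact: ltr01.
apply: le_ereal_inf_tmp => _ [U _ <-]; apply: nneseries_ge0 => i _ _.
exact: dpow_ge0.
Qed.

(** Each piece is paired with its product of ratios, not its diameter, so that the sum of powers is
    exactly multiplicative from level to level. *)
Lemma attractor_cover (I : finType) (f : I -> R -> R) (rho : I -> R) K s (m : R) :
  (forall x y, K x -> K y -> `|x - y| <= 1) ->
  (forall i, 0 <= rho i <= m) ->
  (forall i x y, `|f i x - f i y| <= rho i * `|x - y|) ->
  (forall x, K x -> exists i, exists2 y, K y & x = f i y) ->
  forall n, exists L : seq (set R * R),
    [/\ forall x, K x -> exists2 c, c \in L & c.1 x,
        forall c, c \in L -> 0 <= c.2 <= m ^+ n /\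
          forall x y, c.1 x -> c.1 y -> `|x - y| <= c.2
      & \sum_(c <- L) c.2 `^ s = (\sum_i rho i `^ s) ^+ n].
Proof.
move=> K1 rhom flip Kf; elim=> [|n [L [KL Ld Lsum]]].
  exists [:: (K, 1)]; split => [x Kx|c|].
  - by exists (K, 1); rewrite ?mem_head.
  - by rewrite inE => /eqP->/=; rewrite expr0 ler01 lexx.
  - by rewrite big_seq1 powR1 expr0.
exists [seq (f i @` c.1, rho i * c.2) | i <- enum I, c <- L]; split.
- move=> x /Kf[i [y Ky ->]]; have [c cL cy] := KL _ Ky.
  exists (f i @` c.1, rho i * c.2); last by exists y.
  by apply/allpairsP; exists (i, c); rewrite mem_enum.
- move=> _ /allpairsP[[i c] [/= _ /Ld[/andP[c0 cm] cd] ->]] /=.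
  have /andP[ri0 rim] := rhom i; split.
    by rewrite mulr_ge0//= exprS ler_pM.
  move=> _ _ [x cx <-] [y cy <-]; apply: le_trans (flip _ _ _) _.
  by rewrite ler_wpM2l// cd.
- rewrite big_allpairs_dep exprS -Lsum big_enum/= mulr_suml; apply: eq_bigr => i _.
  rewrite mulr_sumr big_seq [RHS]big_seq; apply: eq_bigr => c /Ld[/andP[c0 _] _].
  by rewrite powRM//; have /andP[] := rhom i.
Qed.

Lemma hausdorff_measure_eq0 (I : finType) (f : I -> R -> R) (rho : I -> R)
    K s (m : R) :
  0 <= s -> m < 1 ->
  (forall x y, K x -> K y -> `|x - y| <= 1) ->
  (forall i, 0 <= rho i <= m) ->
  (forall i x y, `|f i x - f i y| <= rho i * `|x - y|) ->
  (forall x, K x -> exists i, exists2 y, K y & x = f i y) ->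
  0 <= m -> \sum_i rho i `^ s < 1 ->
  hausdorff_measure s K = 0%E.
Proof.
move=> s0 m1 K1 rhom flip Kf m0 sum1; apply/eqP.
rewrite eq_le hausdorff_measure_ge0 andbT.
apply: ge_ereal_sup => _ [d /= d0 <-]; apply/lee_addgt0Pr => e e0; rewrite add0e.
set phi := \sum_i _ in sum1.
have phi0 : 0 <= phi by rewrite sumr_ge0// => *; exact: powR_ge0.
have small (z c : R) : 0 <= z < 1 -> 0 < c -> \forall n \near \oo, z ^+ n <= c.
  move=> /andP[z0 z1] c0; have zn : `|z| < 1 by rewrite ger0_norm.
  near=> n; apply: le_trans (ler_norm _) _.
  by near: n; exact: (cvgr0_norm_le _ (cvg_expr zn)).
have m01 : 0 <= m < 1 by rewrite m0.
have phi01 : 0 <= phi < 1 by rewrite phi0.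
have [n [mn phin]] := filter_ex (filterI (small _ _ m01 d0) (small _ _ phi01 e0)).
have [L [KL Ld Lsum]] := @attractor_cover _ f rho K s m K1 rhom flip Kf n.
apply: (@le_trans _ _ ((phi ^+ n)%:E)); last by rewrite lee_fin.
(* Beyond the length of [L] the default makes [U i] empty, and such members contribute 0 to the
   series. *)
pose U i := (nth (set0, 0) L i).1.
apply: (@le_trans _ _ (\sum_(0 <= i <oo) dpow s (U i))%E).
  apply: ereal_inf_lbound; exists U => //; split=> [x /KL[c cL cx]|i].
    by exists (index c L) => //; rewrite /U nth_index.
  have [iL|Li] := ltnP i (size L); last first.
    by apply: diamE_le => x y; rewrite /U nth_default.
  have [/andP[_ cm] cd] := Ld _ (mem_nth (set0, 0) iL).
  by apply: diamE_le => x y Ux Uy; rewrite (le_trans (cd _ _ Ux Uy))// (le_trans cm).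
rewrite (nneseries_split 0 (size L)); last by move=> *; exact: dpow_ge0.
rewrite add0n eseries0 ?adde0; last first.
  move=> i Li _; rewrite /U nth_default// /dpow; by case: pselect.
rewrite -Lsum -sumEFin (big_nth (set0, 0)) big_seq [leRHS]big_seq lee_sum// => i.
rewrite mem_index_iota => /andP[_ iL].
have [/andP[c0 _] cd] := Ld _ (mem_nth (set0, 0) iL).
have [Ui0|Ui0] := pselect (U i !=set0); last first.
  rewrite /dpow; case: pselect => [? /=|]; first by rewrite lee_fin powR_ge0.
  by move: Ui0 => /nonemptyPn.
have [r [/andP[r0 rc] _ ->]] := dpow_bounded s _ _ Ui0 (diamE_le _ _ cd).
by rewrite lee_fin ge0_ler_powR ?nnegrE.
Unshelve. all: by end_near. Qed.
End Hausdorff_bounds.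

(** * Compositions along words and products of ratios *)

Section Words.
Context {R : realType} {I : finType}.
Implicit Types (f : I -> R -> R) (rho g : I -> R).

Lemma dist_foldr f rho (w : seq I) x y :
  (forall i u v, `|f i u - f i v| = rho i * `|u - v|) ->
  `|foldr f x w - foldr f y w| = (\prod_(i <- w) rho i) * `|x - y|.
Proof.
move=> fsim; elim: w => [|i w IH] /=; first by rewrite big_nil mul1r.
by rewrite fsim IH big_cons mulrA.
Qed.

Lemma foldr_stable f (K : set R) (w : seq I) x :
  (forall i u, K u -> K (f i u)) -> K x -> K (foldr f x w).
Proof. by move=> fK Kx; elim: w => //= i w; exact: fK. Qed.

Lemma powR_prod rho (w : seq I) s : (forall i, 0 <= rho i) ->
  (\prod_(i <- w) rho i) `^ s = \prod_(i <- w) rho i `^ s.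
Proof.
move=> rho0; elim: w => [|i w IH]; first by rewrite !big_nil powR1.
by rewrite !big_cons powRM ?IH// prodr_ge0.
Qed.

(** Expanding the power by distributivity gives a sum over functions ['I_n -> I], which [h] and [k]
    identify with words. *)
Lemma sum_tuple_prod n g :
  \sum_(w : n.-tuple I) \prod_(i <- w) g i = (\sum_i g i) ^+ n.
Proof.
rewrite -[in RHS](card_ord n) -prodr_const bigA_distr_bigA/=.
pose h (w : n.-tuple I) : {ffun 'I_n -> I} := [ffun j => tnth w j].
pose k (u : {ffun 'I_n -> I}) : n.-tuple I := [tuple u j | j < n].
rewrite (reindex h); last first.
  exists k => u _; first by apply: eq_from_tnth => j; rewrite tnth_mktuple ffunE.
  by apply/ffunP => j; rewrite ffunE tnth_mktuple.
by apply: eq_bigr => w _; rewrite big_tuple; apply: eq_bigr => j _; rewrite ffunE.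
Qed.

End Words.

Lemma ltr_powR_lt1 {R : realType} (a s t : R) : 0 < a < 1 -> s < t -> a `^ t < a `^ s.
Proof.
move=> a01 st; have /andP[a0 _] := a01.
by rewrite /powR gt_eqF// ltr_expR ltr_nM2r// ln_lt0.
Qed.

Lemma powR_continuous {R : realType} (a : R) : 0 < a -> continuous (powR a).
Proof.
move=> a0 s; have -> : powR a = fun t => expR (t * ln a).
  by apply/funext => t; rewrite /powR gt_eqF.
apply: continuous_comp; last exact: continuous_expR.
by apply: cvgM; [exact: cvg_id | exact: cvg_cst].
Qed.

Lemma is_attractorP {R : realType} (S : seq (R -> R)) (K : set R) :
  is_attractor S K ->
  (forall x, K x -> exists i : 'I_(size S), exists2 y, K y & x = nth id S i y) /\
  (forall (i : 'I_(size S)) x, K x -> K (nth id S i x)).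
Proof.
case=> _ _; rewrite (big_nth id) big_mkord.
rewrite -(bigcup_mkord _ (fun i => nth id S i @` K)) => KE.
split.
  by move=> x; rewrite {1}KE => -[i /= iS [y Ky <-]]; exists (Ordinal iS), y.
by move=> i x Kx; rewrite KE; exists i => //=; exists x.
Qed.

(** * The six maps: location of the attractor and separation of its pieces *)

Section Six_maps.
Context {R : realType} (p q r : R)
  (hp : 0 < p < 1 / 36) (hq : 0 < q < 1 / 36) (hr : 0 < r < 1 / 36).

Definition maps6 : seq (R -> R) :=
  [:: fun x => p * x; fun x => 3 / 15 + r * x; fun x => 8 / 15 - q * x;
      fun x => 8 / 15 - r + r * x; fun x => 1 - 3 / 15 - r * x;
      fun x => 1 - r + r * x].

(* The letters are numbered from 0: [map6 i] is [S_(i+1)] of the paper. *)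
Definition map6 (i : 'I_6) : R -> R := nth id maps6 i.
Definition ratio6 (i : 'I_6) : R := nth 0 [:: p; r; q; r; r; r] i.

Lemma ratio6_bounds i : 0 < ratio6 i < 1 / 36.
Proof. by case: i => -[|[|[|[|[|[|]]]]]]. Qed.

Lemma map6_similar i x y : `|map6 i x - map6 i y| = ratio6 i * `|x - y|.
Proof.
have /andP[/ltW ri0 _] := ratio6_bounds i.
rewrite -[X in X * _]ger0_norm// -normrM.
have [->|->] : map6 i x - map6 i y = ratio6 i * (x - y) \/
    map6 i x - map6 i y = - (ratio6 i * (x - y)); last 2 first.
- by [].
- by rewrite normrN.
rewrite /map6 /ratio6; case: i ri0 => -[|[|[|[|[|[|]]]]]] //= _ _;
  by [left; ring|right; ring].
Qed.

Lemma ratio6_sum s : \sum_i ratio6 i `^ s = p `^ s + q `^ s + 4 * r `^ s.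
Proof. by rewrite /ratio6 !big_ord_recl big_ord0 /=; ring. Qed.

(** The image of the unit interval has centre [map6 i (1 / 2)] and half-length [ratio6 i / 2], and
    stays in the unit interval. Hence any excess of the distance over [1 / 2] shrinks by
    [ratio6 i]. *)
Lemma map6_dist_half i x :
  `|map6 i x - 1 / 2| <= 1 / 2 - ratio6 i / 2 + ratio6 i * `|x - 1 / 2|.
Proof.
have /andP[ri0 ri1] := ratio6_bounds i.
apply: le_trans (ler_distD (map6 i (1 / 2)) _ _) _.
rewrite map6_similar addrC lerD2r ler_norml.
move: ri0 ri1; rewrite /map6 /ratio6; case: i => -[|[|[|[|[|[|]]]]]] //= _ ? ?; lra.
Qed.

(** Every point of [K] is an image of a point of [K], so a positive excess of [sup D] over [1 / 2]
    would be at most a 36th of itself. *)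
Lemma attractor_unit (K : set R) x : is_attractor maps6 K -> K x -> 0 <= x <= 1.
Proof.
move=> aK; have [Kf _] := is_attractorP _ _ aK; have [cK K0 _] := aK.
pose D := [set `|x - 1 / 2| | x in K].
have supD : has_sup D.
  split; first by case: K0 => y Ky; exists `|y - 1 / 2|, y.
  have [M [_ /(_ (M + 1))]] := compact_bounded cK.
  rewrite ltrDl ltr01 => /(_ isT) KM; exists (M + 1 + 1 / 2) => _ [y Ky <-].
  apply: le_trans (ler_normB _ _) _; rewrite lerD ?KM//.
  by rewrite ger0_norm.
have Dle y : K y -> `|y - 1 / 2| <= sup D.
  by move=> Ky; apply: sup_upper_bound => //; exists y.
have supD2 : sup D <= 1 / 2.
  rewrite leNgt; apply/negP => D2.
  suff : sup D <= 1 / 2 + (sup D - 1 / 2) / 36 by lra.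
  apply: ge_sup; first by case: supD.
  move=> _ [y /Kf[i [z /Dle Dz ->]] <-].
  apply: le_trans (map6_dist_half i z) _.
  have /andP[ri0 ri1] := ratio6_bounds i; nra.
by move=> /Dle /le_trans/(_ supD2); rewrite ler_norml => ?; lra.
Qed.

(* Since [S_3 y = h] only for [y = 0], this keeps [S_3] followed by a word ending
   with the letter [2] away from the overlap point [h]. *)
Lemma foldr_map6_gt0 (K : set R) (w : seq 'I_6) x : is_attractor maps6 K -> K x ->
  0 < foldr map6 (3 / 15 + r * x) w.
Proof.
move=> aK Kx; have [_ fK] := is_attractorP _ _ aK.
have K1 := attractor_unit _ _ aK.
have Kw v : K (foldr map6 (3 / 15 + r * x) v).
  by apply: foldr_stable => //; exact: (fK (@Ordinal 6 1 isT)).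
elim: w => [|i w]/=.
  by have /andP[x0 _] := K1 _ Kx; move: hr => /andP[? ?]; nra.
(* Of the six images of the unit interval only that of the letter 0 contains 0, and [p * z] is
   positive when [z] is. *)
move: (foldr _ _ w) (K1 _ (Kw w)) => z /andP[_ z1] z0.
move: hp hq hr => /andP[? ?] /andP[? ?] /andP[? ?].
rewrite /map6; case: i => -[|[|[|[|[|[|]]]]]] //= _; nra.
Qed.

Lemma map6_inj i : injective (map6 i).
Proof.
move=> x y xy; have := map6_similar i x y; rewrite xy subrr normr0 => /esym/eqP.
have /andP[ri0 _] := ratio6_bounds i.
by rewrite mulf_eq0 gt_eqF//= normr_eq0 subr_eq0 => /eqP.
Qed.

(** The images of the unit interval are shorter than [1 / 36], too short to meet except for the
    letters 2 and 3, which share the right endpoint [8 / 15]. *)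
Lemma map6_overlap (i j : 'I_6) (x y : R) : 0 <= x <= 1 -> 0 <= y <= 1 -> (i < j)%N ->
  map6 i x = map6 j y -> i = 2 :> nat /\ j = 3 :> nat.
Proof.
move=> /andP[? ?] /andP[? ?]; move: hp hq hr => /andP[? ?] /andP[? ?] /andP[? ?].
rewrite /map6; case: i => -[|[|[|[|[|[|]]]]]] //= _;
  case: j => -[|[|[|[|[|[|]]]]]] //= _ _ E //; exfalso; nra.
Qed.

(** Equal first letters cancel by injectivity. Distinct ones put the common point at
    [8 / 15 = 8 / 15 - q * c], against [c > 0]. Since [x] and [y] may differ, this is disjointness
    of the pieces. *)
Lemma foldr_map6_inj (K : set R) (v w : seq 'I_6) x y : is_attractor maps6 K ->
  (fun x => 8 / 15 - q * x) @` K `&` (fun x => 8 / 15 - r + r * x) @` K = [set 8 / 15] ->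
  K x -> K y -> size v = size w ->
  foldr map6 (3 / 15 + r * x) v = foldr map6 (3 / 15 + r * y) w -> v = w.
Proof.
move=> aK Kh; have [_ fK] := is_attractorP _ _ aK.
have K1 := attractor_unit _ _ aK.
have Kw u z : K z -> K (foldr map6 (3 / 15 + r * z) u).
  by move=> Kz; apply: foldr_stable => //; exact: (fK (@Ordinal 6 1 isT)).
have no34 (i j : 'I_6) u u' z z' : K z -> K z' -> (i < j)%N ->
    map6 i (foldr map6 (3 / 15 + r * z) u) <> map6 j (foldr map6 (3 / 15 + r * z') u').
  move=> Kz Kz' ij E.
  have [i2 j3] :=
    map6_overlap _ _ _ _ (K1 _ (Kw u _ Kz)) (K1 _ (Kw u' _ Kz')) ij E.
  have := foldr_map6_gt0 _ u _ aK Kz; have := Kw u _ Kz; have := Kw u' _ Kz'; move: E.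
  move: (foldr _ _ u) (foldr _ _ u') => c c' E Kc' Kc c0.
  have : [set 8 / 15] (map6 i c).
    rewrite -Kh; split; last rewrite E.
      by exists c => //; rewrite /map6 i2.
    by exists c' => //; rewrite /map6 j3.
  rewrite /map6 i2 /= => /eqP; rewrite eq_sym -subr_eq0 subKr.
  by have /andP[q0 _] := hq; rewrite gt_eqF// mulr_gt0.
elim: v w x y => [|i v IH] [|j w] x y //= Kx Ky [vw] E.
have [ij|ji|ij] := ltngtP i j.
- by case: (no34 _ _ _ _ _ _ Kx Ky ij E).
- by case: (no34 _ _ _ _ _ _ Ky Kx ji (esym E)).
have {}ij : i = j by exact: val_inj.
by rewrite ij; move: E; rewrite ij => /map6_inj/(IH _ _ _ Kx Ky vw)->.
Qed.

End Six_maps.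

(** * The dimension as the root of [phi s = 1] *)

Theorem theorem5 (R : realType) (p q r : R)
  (hp : 0 < p < 1 / 36) (hq : 0 < q < 1 / 36) (hr : 0 < r < 1 / 36)
  (K : set R) :
  let h : R := 8 / 15 in
  let a : R := 3 / 15 in
  let S1 := fun x : R => p * x in
  let S2 := fun x : R => a + r * x in
  let S3 := fun x : R => h - q * x in
  let S4 := fun x : R => h - r + r * x in
  let S5 := fun x : R => 1 - a - r * x in
  let S6 := fun x : R => 1 - r + r * x in
  is_attractor [:: S1; S2; S3; S4; S5; S6] K ->
  S3 @` K `&` S4 @` K = [set h] ->
  exists d : R, hausdorff_dim K = d%:E /\
    p `^ d + q `^ d + 4 * r `^ d = 1.
Proof.
move=> h a S1 S2 S3 S4 S5 S6 aK Kh.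
pose phi s := p `^ s + q `^ s + 4 * r `^ s.
have /andP[p0 p1] := hp; have /andP[q0 q1] := hq; have /andP[r0 r1] := hr.
have phi_decr s t : s < t -> phi t < phi s.
  move=> st; have powlt (b : R) : 0 < b < 1 / 36 -> b `^ t < b `^ s.
    by move=> /andP[b0 b1]; apply: ltr_powR_lt1 => //; rewrite b0/=; lra.
  by have := powlt _ hp; have := powlt _ hq; have := powlt _ hr; rewrite /phi; lra.
have phi_cont : {within `[0, 1], continuous phi}.
  apply: continuous_subspaceT => s; rewrite /phi.
  apply: cvgD; first by apply: cvgD; exact: powR_continuous.
  by apply: cvgM; [exact: cvg_cst | exact: powR_continuous].
(* [phi 0 = 6], while [phi 1 = p + q + 4 * r] is below [6 / 36]. *)
have phi1 : Num.min (phi 0) (phi 1) <= 1 <= Num.max (phi 0) (phi 1).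
  rewrite ge_min le_max /phi !powRr0 !powRr1 ?(ltW p0) ?(ltW q0) ?(ltW r0)//.
  by apply/andP; split; apply/orP; [right|left]; lra.
have [d /itvP d01 phid] := IVT ler01 phi_cont phi1.
have d0 : 0 <= d by rewrite d01.
exists d; split => //.
have [cK K0 _] := aK; have [Kf fK] := is_attractorP _ _ aK.
have K1 := attractor_unit _ _ _ hp hq hr _ _ aK.
have ratio_bounds := ratio6_bounds _ _ _ hp hq hr.
have similar := map6_similar _ _ _ hp hq hr.
apply/eqP; rewrite eq_le; apply/andP; split.
  apply/lee_addgt0Pr => e e0; apply: ereal_inf_lbound; exists (d + e) => //=.
  split; first by rewrite addr_ge0// ltW.
  apply: (@hausdorff_measure_eq0 _ _ (map6 p q r) (ratio6 p q r) _ _ (1 / 36)) => //.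
  - by rewrite addr_ge0// ltW.
  - by lra.
  - by move=> x y /K1 ? /K1 ?; rewrite ler_norml; lra.
  - by move=> i; have /andP[/ltW -> /ltW ->] := ratio_bounds i.
  - by move=> i x y; rewrite similar.
  - by have := phi_decr d (d + e); rewrite phid ltrDl ratio6_sum; exact.
apply: le_ereal_inf_tmp => _ [s [s0 Hs0] <-]; rewrite lee_fin leNgt; apply/negP => sd.
have phis : 1 < phi s by rewrite -phid phi_decr.
have [n [n0 phin]] : exists n, (0 < n)%N /\ 1 <= phi s ^+ n * r `^ s.
  have phis0 : 0 < phi s by exact: lt_trans phis.
  have zlt : `|(phi s)^-1| < 1 by rewrite ger0_norm ?invr_ge0 ?ltW// invf_lt1.
  have rs0 : 0 < r `^ s by exact: powR_gt0.
  have [n [n0 zn]] := filter_ex (filterI (nbhs_infty_gt 0)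
    (cvgr0_norm_le _ (cvg_expr zlt) _ rs0)).
  exists n; split => //; move: zn => /=.
  rewrite ger0_norm ?exprn_ge0 ?invr_ge0 ?(ltW phis0)//.
  have phin0 : 0 < phi s ^+ n by rewrite exprn_gt0.
  by rewrite exprVn => zn; rewrite -(divff (lt0r_neq0 phin0)) ler_pM2l.
(* The innermost map is [S2], the letter 1 in the numbering from 0; it contributes the factor [r] of
   [rho]. *)
pose f (w : n.-tuple 'I_6) x := foldr (map6 p q r) (3 / 15 + r * x) w.
pose rho (w : n.-tuple 'I_6) := (\prod_(i <- w) ratio6 p q r i) * r.
have ratio_ge0 i : 0 <= ratio6 p q r i by have /andP[/ltW] := ratio_bounds i.
have prod_gt0 (w : seq 'I_6) : 0 < \prod_(i <- w) ratio6 p q r i.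
  by apply: prodr_gt0 => i _; have /andP[] := ratio_bounds i.
apply: (@hausdorff_measure_neq0 _ _ f rho K s) Hs0 => //.
- by rewrite card_tuple card_ord -{1}(expn0 6) ltn_exp2l.
- by move=> w; rewrite mulr_gt0.
- move=> w x y; rewrite /f (dist_foldr _ _ _ _ _ similar) /rho -mulrA; congr (_ * _).
  exact: (similar (@Ordinal 6 1 isT)).
- by move=> w x Kx; apply: foldr_stable => //; exact: (fK (@Ordinal 6 1 isT)).
- move=> v w vw; rewrite -subset0 => _ [[x Kx <-] [y Ky E]].
  move: vw; have -> : v = w.
    apply: val_inj.
    apply: (foldr_map6_inj _ _ _ hp hq hr K _ _ x y aK Kh) => //.
    by rewrite !size_tuple.
  by rewrite eqxx.
- under eq_bigr => w _ do rewrite /rho powRM ?ltW// powR_prod//.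
  by rewrite -mulr_suml sum_tuple_prod ratio6_sum.
Qed.
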